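(* Let $0<p<1$ and let $X_1,X_2,\dots$ be independent identically distributed random variables with $\mathbf{Pr}(X_i=1)=p$ and $\mathbf{Pr}(X_i=0)=1-p$. Then there exists a sequence of deviations $\varepsilon(n)>0$ such that, as $n\to\infty$, $\varepsilon(n)\to0$, $\varepsilon(n)^2n\to0$, and $\mathcal{P}^-_2+\mathcal{P}^+_2\to1$.
   Context: For each $n$, with $\varepsilon=\varepsilon(n)$, $$\mathcal{P}^+_2:=\mathbf{Pr}\left(\varepsilon<\frac1n\sum_{i=1}^nX_i-p\right),\qquad \mathcal{P}^-_2:=\mathbf{Pr}\left(\varepsilon<p-\frac1n\sum_{i=1}^nX_i\right),$$ so that $\mathcal{P}^-_2+\mathcal{P}^+_2=\mathbf{Pr}\left(\left|\frac1n\sum_{i=1}^nX_i-p\right|>\varepsilon(n)\right)$. *)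

(* Defs.v *)
From HB Require Import structures.
From mathcomp Require Import all_boot all_order all_algebra finmap.
From mathcomp Require Import all_classical all_reals all_analysis.

Set Implicit Arguments.
Unset Strict Implicit.
Unset Printing Implicit Defensive.

Import Order.TTheory GRing.Theory Num.Theory.
Import numFieldNormedType.Exports.

Local Open Scope classical_set_scope.
Local Open Scope ring_scope.

Section iid.
Context {d d' : measure_display} {T : measurableType d} {T' : measurableType d'}
  {R : realType} (P : probability T R).

Definition mutually_independent (I : choiceType) (X : I -> {RV P >-> T'}) : Prop :=
  forall (J : {fset I}) (B : I -> set T'),
    (forall i, i \in J -> measurable (B i)) ->
    P (\bigcap_(i in [set` J]) (X i @^-1` B i)) =
    (\prod_(i <- J) P (X i @^-1` B i))%E.

Definition identically_distributed (I : Type) (X : I -> {RV P >-> T'}) : Prop :=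
  forall (i j : I) (A : set T'), measurable A ->
    distribution P (X i) A = distribution P (X j) A.

Definition iid (I : choiceType) (X : I -> {RV P >-> T'}) : Prop :=
  mutually_independent X /\ identically_distributed X.

End iid.

Section tails.
Context {d : measure_display} {T : measurableType d} {R : realType}
  (P : probability T R).

(* [X i] stands for X_{i+1}, so the mean below is over X_1, ..., X_n;
   it is 0 for n = 0. *)
Definition sample_mean (X : nat -> {RV P >-> R}) (n : nat) (w : T) : R :=
  n%:R^-1 * \sum_(i < n) X i w.

Definition upper_tail (X : nat -> {RV P >-> R}) (p : R) (eps : R^nat) (n : nat) :
    \bar R :=
  P [set w | eps n < sample_mean X n w - p].

Definition lower_tail (X : nat -> {RV P >-> R}) (p : R) (eps : R^nat) (n : nat) :
    \bar R :=
  P [set w | eps n < p - sample_mean X n w].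

End tails.

(* Main.v *)
Require Import Defs.
From HB Require Import structures.
From mathcomp Require Import all_boot all_order all_algebra finmap.
From mathcomp Require Import all_classical all_reals all_analysis.
From mathcomp Require Import ring lra.
Import Order.TTheory GRing.Theory Num.Theory.
Import numFieldNormedType.Exports.
Local Open Scope classical_set_scope.
Local Open Scope ring_scope.

(** The law of S_n = X_1 + ... + X_n spreads out: no single value keeps a
    fixed share of the mass as n grows.  So if the window of half-width
    n * eps(n) around n * p has length less than 1, it holds at most one
    integer, S_n (an integer almost surely) falls in it with probability
    tending to 0, and the two tails together have probability tending to 1.
    With eps(n) = 1 / (2 (n + 1)) the window has half-width below 1/2, and
    both eps(n) and eps(n)^2 * n <= eps(n) tend to 0.

    Two facts carry the argument.  First, the probability that S_n = k is at
    most the binomial weight b(n,k) (probability_le_binomial_pmf): up to a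
    null set the event is covered by the C(n,k) events that fix which k of the
    first n trials are successes, and independence gives each of them the
    probability p^k (1-p)^(n-k).  Second, b(n,k_n) tends to 0 as soon as k_n
    stays within distance 1 of n * p (binomial_pmf_near_mean_cvg0).  The ratio
    b(n,k+j+1) / b(n,k+j) tends to 1 for k near n * p and j fixed, so for
    every M the M weights b(n,k), ..., b(n,k+M-1) are all at least b(n,k) / 2
    once n is large; they sum to at most 1, whence b(n,k) <= 2 / M. *)

(** * Binomial weights near the mean *)

Lemma sum_binomial_pmf (R : realType) (n : nat) (p : R) :
  \sum_(k < n.+1) binomial_pmf n p k = 1.
Proof.
have -> : (1 : R) = ((1 - p) + p) ^+ n by rewrite subrK expr1n.
rewrite exprDn.
by apply: eq_bigr => k _; rewrite /binomial_pmf mulrC.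
Qed.

Lemma binomial_pmf_small (R : realType) (n k : nat) (p : R) :
  (n < k)%N -> binomial_pmf n p k = 0.
Proof. by move=> nk; rewrite /binomial_pmf bin_small. Qed.

(** Zero weights beyond n complete any window to an initial segment of the
    indices that contains 0, ..., n. *)
Lemma sum_binomial_pmf_window (R : realType) (n k M : nat) (p : R) :
  0 <= p <= 1 -> \sum_(j < M) binomial_pmf n p (k + j) <= 1.
Proof.
move=> p01.
have b0 i : 0 <= binomial_pmf n p i by exact: binomial_pmf_ge0.
have : \sum_(i < k + M + n.+1) binomial_pmf n p i = 1.
  rewrite addnC big_split_ord /= sum_binomial_pmf big1 ?addr0// => i _.
  by rewrite binomial_pmf_small// ltn_addr.
move=> <-; rewrite !big_split_ord /= -addrA addrCA lerDl.
by rewrite addr_ge0// sumr_ge0.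
Qed.

(** The ratio of consecutive weights is ((n - k) p) / ((k + 1) (1 - p)).  The
    product form also holds from k = n on, where the truncated n - k and the
    weight of k + 1 vanish. *)
Lemma binomial_pmf_rec (R : realType) (n k : nat) (p : R) :
  k.+1%:R * (1 - p) * binomial_pmf n p k.+1
  = (n - k)%:R * p * binomial_pmf n p k.
Proof.
have [kn|nk] := ltnP k n; last first.
  rewrite binomial_pmf_small ?ltnS//.
  by move: nk; rewrite -subn_eq0 => /eqP ->; rewrite mulr0 !mul0r.
rewrite /binomial_pmf /unstable.onem -[_ *+ 'C(n, k.+1)]mulr_natr -[_ *+ 'C(n, k)]mulr_natr.
rewrite [p ^+ k.+1]exprS.
have -> : (1 - p) ^+ (n - k) = (1 - p) * (1 - p) ^+ (n - k.+1).
  by rewrite -exprS subnSK.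
have := congr1 (fun m : nat => m%:R : R) (mul_bin_left n k).
rewrite !natrM => e.
transitivity (p * p ^+ k * ((1 - p) * (1 - p) ^+ (n - k.+1)) * (k.+1%:R * 'C(n, k.+1)%:R)).
  by ring.
by rewrite e; ring.
Qed.

(** With c = n p (1 - p), being within 1 of the mean makes the numerator of the
    ratio b(n,k+j+1) / b(n,k+j) at least c - (j + 1) and its denominator at
    most c + (j + 2), and 1 - (2 j + 3) / (c + j + 2) exceeds
    1 - (2 j + 3) / c. *)
Lemma binomial_pmf_step (R : realType) (n k j : nat) (p : R) :
  0 < p -> p < 1 -> `|k%:R - n%:R * p| <= 1 ->
  j.+1%:R <= n%:R * p * (1 - p) ->
  (1 - (2 * j%:R + 3) / (n%:R * p * (1 - p))) * binomial_pmf n p (k + j)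
  <= binomial_pmf n p (k + j).+1.
Proof.
move=> p0 p1 kn.
(* An opaque c keeps the degrees seen by nra low. *)
have [c cE] : exists c, c = n%:R * p * (1 - p) by eexists.
rewrite -cE => jc.
have c0 : 0 < c by apply: lt_le_trans jc.
have b0 i : 0 <= binomial_pmf n p i by apply: binomial_pmf_ge0; rewrite !ltW.
have := binomial_pmf_rec R n (k + j) p.
set b := binomial_pmf n p (k + j); set b' := binomial_pmf n p (k + j).+1.
move=> rec; have hb : 0 <= b := b0 _; have hb' : 0 <= b' := b0 _.
move: kn; rewrite ler_norml => /andP[kn1 kn2].
have sub : n%:R - k%:R - j%:R <= (n - (k + j))%:R :> R.
  rewrite -subr_ge0; have [le|/ltnW lt] := leqP (k + j) n.
    by rewrite natrB// natrD; lra.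
  have := lt; rewrite -subn_eq0 => /eqP ->.
  by move: lt; rewrite -(ler_nat R) natrD; lra.
have j0 : 0 <= j%:R :> R by [].
have jE : j.+1%:R = j%:R + 1 :> R by rewrite -natr1.
have lo : c - j.+1%:R <= (n - (k + j))%:R * p.
  apply: le_trans (ler_wpM2r (ltW p0) sub); rewrite cE jE; nra.
have hi : (k + j).+1%:R * (1 - p) <= c + (j%:R + 2).
  rewrite -natr1 natrD cE; nra.
have key : (c - j.+1%:R) * b <= (c + (j%:R + 2)) * b'.
  apply: le_trans (ler_wpM2r hb' hi); rewrite rec; exact: ler_wpM2r.
have cj : 0 < c + (j%:R + 2) by lra.
rewrite -(ler_pM2l cj); apply: le_trans key; rewrite mulrA ler_wpM2r//.
rewrite mulrBr mulr1 mulrA.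
have -> : c - j.+1%:R = c + (j%:R + 2) - (2 * j%:R + 3) by rewrite jE; ring.
rewrite lerD2l lerN2 ler_pdivlMr//.
rewrite mulrC ler_wpM2r//; lra.
Qed.

(** The factors 1 - (2 i + 3) / c for i < j multiply to at least one minus the
    sum of the (2 i + 3) / c, and that sum is j (j + 2) / c. *)
Lemma binomial_pmf_near_mean_ge (R : realType) (n k j : nat) (p : R) :
  0 < p -> p < 1 -> `|k%:R - n%:R * p| <= 1 ->
  j%:R * (j%:R + 2) <= n%:R * p * (1 - p) ->
  (1 - j%:R * (j%:R + 2) / (n%:R * p * (1 - p))) * binomial_pmf n p k
  <= binomial_pmf n p (k + j).
Proof.
move=> p0 p1 kn.
have b0 i : 0 <= binomial_pmf n p i by apply: binomial_pmf_ge0; rewrite !ltW.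
elim: j => [|j IH]; first by rewrite mul0r mul0r subr0 mul1r addn0.
have j0 : 0 <= j%:R :> R by [].
have [c cE] : exists c, c = n%:R * p * (1 - p) by eexists.
rewrite addnS -natr1 -cE => jc; rewrite -cE in IH.
have c0 : 0 < c by nra.
have jc1 : j.+1%:R <= c by rewrite -natr1; nra.
have jc2 : j%:R * (j%:R + 2) <= c by nra.
apply: le_trans (binomial_pmf_step R n k j p p0 p1 kn _); rewrite -cE//.
have h : 0 <= 1 - (2 * j%:R + 3) / c.
  rewrite subr_ge0 ler_pdivrMr// mul1r; nra.
apply: le_trans (ler_wpM2l h (IH jc2)).
rewrite mulrA ler_wpM2r//.
have -> : (j%:R + 1) * (j%:R + 1 + 2) / c = j%:R * (j%:R + 2) / c + (2 * j%:R + 3) / c.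
  by rewrite -mulrDl; congr (_ / _); ring.
have : 0 <= j%:R * (j%:R + 2) / c by apply: divr_ge0 (ltW c0); apply: mulr_ge0 => //; lra.
have : 0 <= (2 * j%:R + 3) / c by apply: divr_ge0 (ltW c0); lra.
nra.
Qed.

(** The hypothesis on M is what makes the M weights from b(n,k) on at least
    b(n,k) / 2, while their sum is at most 1. *)
Lemma binomial_pmf_near_mean_le (R : realType) (n k M : nat) (p : R) :
  0 < p -> p < 1 -> `|k%:R - n%:R * p| <= 1 ->
  2 * (M%:R * (M%:R + 2)) <= n%:R * p * (1 - p) ->
  M%:R * binomial_pmf n p k <= 2.
Proof.
move=> p0 p1 kn.
have [c cE] : exists c, c = n%:R * p * (1 - p) by eexists.
rewrite -cE => Mc.
have b0 i : 0 <= binomial_pmf n p i by apply: binomial_pmf_ge0; rewrite !ltW.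
have p01 : 0 <= p <= 1 by rewrite !ltW.
have h : \sum_(j < M) (binomial_pmf n p k / 2) <= 1.
  apply: le_trans (sum_binomial_pmf_window R n k M p p01).
  apply: ler_sum => -[j jM] _ /=.
  have j0 : 0 <= j%:R :> R by [].
  have jM' : j%:R + 1 <= M%:R :> R by rewrite natr1 ler_nat.
  have c0 : 0 < c by nra.
  have jc : 2 * (j%:R * (j%:R + 2)) <= c by nra.
  have jc' : j%:R * (j%:R + 2) <= c by nra.
  apply: le_trans (binomial_pmf_near_mean_ge R n k j p p0 p1 kn _); rewrite -cE//.
  rewrite mulrC ler_wpM2r//.
  have : j%:R * (j%:R + 2) / c <= 2^-1 by rewrite ler_pdivrMr//; lra.
  lra.
move: h; rewrite sumr_const card_ord -mulr_natl; lra.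
Qed.

Lemma binomial_pmf_near_mean_cvg0 (R : realType) (p : R) (k : nat -> nat) :
  0 < p -> p < 1 -> (forall n, `|(k n)%:R - n%:R * p| <= 1) ->
  binomial_pmf n p (k n) @[n --> \oo] --> (0 : R).
Proof.
move=> p0 p1 kn; apply/cvgrPdist_le => e e0.
(* M weights of size at least e / 2 would exhaust the total mass. *)
pose M := (Num.truncn (2 / e)).+1.
have eM : 2 <= M%:R * e by rewrite -ler_pdivrMr// ltW// truncnS_gt.
have c0 : 0 < p * (1 - p) by rewrite mulr_gt0// subr_gt0.
near=> n.
have b0 : 0 <= binomial_pmf n p (k n) by apply: binomial_pmf_ge0; rewrite !ltW.
rewrite sub0r normrN ger0_norm//.
rewrite -(@ler_pM2l _ M%:R)// (le_trans _ eM)//.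
apply: binomial_pmf_near_mean_le => //.
rewrite -mulrA -ler_pdivrMr//.
near: n; exact: nbhs_infty_ger.
Unshelve. all: by end_near. Qed.

(** * Sums of Bernoulli trials *)

Lemma measure_bigsetU_le {d : measure_display} {T : ringOfSetsType d} {R : realFieldType}
    (mu : {content set T -> \bar R}) (I : Type) (s : seq I) (Q : pred I) (F : I -> set T) :
  (forall i, Q i -> measurable (F i)) ->
  (mu (\big[setU/set0]_(i <- s | Q i) F i) <= \sum_(i <- s | Q i) mu (F i))%E.
Proof.
move=> mF; elim: s => [|i s IH]; first by rewrite !big_nil measure0.
rewrite !big_cons; case: ifPn => // Qi.
apply: (le_trans (measureU2 _ _ _)); [exact: mF|exact: bigsetU_measurable|].
exact: leeD2l.
Qed.

Section bernoulli_trials.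
Context {R : realType} {d : measure_display} {T : measurableType d}
    (P : probability T R).

Lemma independent_finite_prod (X : nat -> {RV P >-> R}) (n : nat) (B : nat -> set R) :
  mutually_independent X -> (forall i, measurable (B i)) ->
  P (\bigcap_(i < n) (X i @^-1` B i)) = (\prod_(i < n) P (X i @^-1` B i))%E.
Proof.
move=> iX mB.
have := iX [fset i in iota 0 n]%fset B (fun i _ => mB i).
have -> : [set` [fset i in iota 0 n]%fset] = [set i | (i < n)%N].
  by apply/seteqP; split => i /=; rewrite inE mem_iota.
move=> ->.
rewrite (perm_big (iota 0 n)); last first.
  by rewrite uniq_perm ?fset_uniq ?iota_uniq// => i; rewrite inE.
by rewrite -[in LHS](subn0 n) big_mkord.
Qed.

Lemma non_bernoulli_null (Y : {RV P >-> R}) (p : R) :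
  P [set w | Y w = 1] = p%:E -> P [set w | Y w = 0] = (1 - p)%:E ->
  P (Y @^-1` ~` [set 0; 1]) = 0.
Proof.
move=> h1 h0.
have m (a : R) : measurable (Y @^-1` [set a]).
  by apply: measurable_funPTI => //; exact: measurable_set1.
rewrite -preimage_setC probability_setC; last first.
  by rewrite preimage_setU; exact: measurableU.
suff -> : P (Y @^-1` [set 0; 1]) = 1%:E by rewrite subee.
transitivity ((1 - p)%:E + p%:E)%E; last by rewrite -EFinD subrK.
rewrite -h0 -h1 preimage_setU; apply: measureU => //.
by rewrite -subset0 => w /= [-> /esym/eqP]; rewrite oner_eq0.
Qed.

Context (p : R) (X : nat -> {RV P >-> R}) (iX : mutually_independent X)
    (hX1 : forall i, P [set w | X i w = 1] = p%:E)
    (hX0 : forall i, P [set w | X i w = 0] = (1 - p)%:E).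

(** The events of this form, over all A, are the possible outcomes of the first
    n trials; A is the set of successes, viewed among the natural numbers. *)
Lemma success_set_probability (n : nat) (A : {set 'I_n}) :
  P (\bigcap_(i < n) (X i @^-1` [set (i \in map val (enum A))%:R])) =
  (p ^+ #|A| * (1 - p) ^+ (n - #|A|))%:E.
Proof.
rewrite independent_finite_prod//.
transitivity (\prod_(i < n) (if i \in A then p else 1 - p)%:E)%E.
  apply: eq_bigr => i _; rewrite mem_map ?mem_enum; last exact: val_inj.
  case: (i \in A); [exact: hX1|exact: hX0].
rewrite prodEFin; congr EFin.
rewrite (bigID (mem A)) /=; congr (_ * _).
  rewrite -prodr_const; apply: eq_bigr => i iA; by rewrite iA.
have -> : (n - #|A|)%N = #|predC (mem A)|.
  by rewrite -(addKn #|A| #|predC _|) cardC card_ord.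
rewrite -prodr_const; apply: eq_bigr => i /negbTE iA; by rewrite iA.
Qed.

(** Subadditivity over the null events where some trial is neither 0 nor 1 and
    over the C(n,k) success sets of size k.  Bounding a general event E that
    forces S_n = k, and not only the event S_n = k, lets E prescribe the value
    of S_n on the Bernoulli outcomes alone. *)
Lemma probability_le_binomial_pmf (n k : nat) (E : set T) :
  measurable E ->
  (forall w, E w -> (forall i, (i < n)%N -> X i w = 0 \/ X i w = 1) ->
    \sum_(i < n) X i w = k%:R) ->
  (P E <= (binomial_pmf n p k)%:E)%E.
Proof.
move=> mE Ek.
pose N i := X i @^-1` ~` [set 0; 1].
pose F (A : {set 'I_n}) := \bigcap_(i < n) (X i @^-1` [set (i \in map val (enum A))%:R]).
have mN i : measurable (N i).
  by apply: measurable_funPTI => //; apply: measurableC; apply: measurableU; exact: measurable_set1.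
have mF A : measurable (F A).
  apply: bigcap_measurableType => i _.
  by apply: measurable_funPTI => //; exact: measurable_set1.
have mNU : measurable (\big[setU/set0]_(i < n) N i) by exact: bigsetU_measurable.
have mFU : measurable (\big[setU/set0]_(A : {set 'I_n} | #|A| == k) F A) by exact: bigsetU_measurable.
have sub : E `<=` (\big[setU/set0]_(i < n) N i) `|`
                  (\big[setU/set0]_(A : {set 'I_n} | #|A| == k) F A).
  move=> w Ew.
  have [[i iN]|nN] := pselect (exists i : 'I_n, N i w).
    by left; rewrite -bigcup_mkord; exists i => /=.
  right.
  have X01 i : (i < n)%N -> X i w = 0 \/ X i w = 1.
    move=> lt; have [//|nX] := pselect (X i w = 0 \/ X i w = 1).
    by exfalso; apply: nN; exists (Ordinal lt).
  (* The success set of the outcome w. *)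
  pose A := [set i : 'I_n | X i w == 1]%SET.
  have XA (i : 'I_n) : X i w = (i \in A)%:R.
    rewrite inE; have [->|->] := X01 i (ltn_ord i); last by rewrite eqxx.
    by rewrite eq_sym oner_eq0.
  have cA : #|A| == k.
    rewrite -(eqr_nat R) -(Ek _ Ew X01) (eq_bigr _ (fun i _ => XA i)).
    rewrite -natr_sum eqr_nat -sum1_card big_mkcond /=.
    by apply/eqP; apply: eq_bigr => i _; case: (i \in A).
  rewrite -bigcup_seq_cond; exists A => /=; first by rewrite mem_index_enum.
  move=> i /= lt; rewrite (XA (Ordinal lt)).
  by rewrite -[i in RHS]/(val (Ordinal lt)) mem_map ?mem_enum; last exact: val_inj.
apply: le_trans (le_measure _ _ _ sub) _; rewrite ?inE//; first exact: measurableU.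
apply: le_trans (measureU2 _ mNU mFU) _.
rewrite -[leRHS]add0e; apply: leeD.
  apply: (le_trans (measure_bigsetU_le _ _ _ _ _ _)) => //.
  by rewrite big1// => i _; exact: non_bernoulli_null (hX1 i) (hX0 i).
apply: (le_trans (measure_bigsetU_le _ _ _ _ _ _)) => //.
rewrite (eq_bigr (fun=> (p ^+ k * (1 - p) ^+ (n - k))%:E)); last first.
  by move=> A /eqP <-; exact: success_set_probability.
rewrite sumEFin lee_fin sumr_const /binomial_pmf /unstable.onem.
by have := card_draws 'I_n k; rewrite cardsE card_ord => ->.
Qed.
End bernoulli_trials.

(** * Deviations of the sample mean *)

Lemma measurable_sample_mean {d} {T : measurableType d} {R : realType} (P : probability T R)
  (X : nat -> {RV P >-> R}) n : measurable_fun setT (sample_mean X n).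
Proof.
apply: measurable_realfun.measurable_funM => //; exact: measurable_sum.
Qed.

Lemma measurable_superlevel {d} {T : measurableType d} {R : realType} (a : R) (g : T -> R) :
  measurable_fun setT g -> measurable [set w | a < g w].
Proof.
move=> mg; have -> : [set w | a < g w] = setT `&` g @^-1` `]a, +oo[.
  by rewrite setTI; apply/seteqP; split => w /=; rewrite in_itv/= andbT.
exact: mg.
Qed.

Lemma tails_complement {d} {T : measurableType d} {R : realType} (P : probability T R)
  (X : nat -> {RV P >-> R}) (p : R) (eps : R^nat) (n : nat) : 0 < eps n ->
  let E := [set w | `|sample_mean X n w - p| <= eps n] in
  measurable E /\ (lower_tail X p eps n + upper_tail X p eps n = 1 - P E)%E.
Proof.
move=> e0 E.
set L := [set w | eps n < p - sample_mean X n w].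
set U := [set w | eps n < sample_mean X n w - p].
have mS := measurable_sample_mean P X n.
have mL : measurable L by apply: measurable_superlevel; exact: measurable_realfun.measurable_funB.
have mU : measurable U by apply: measurable_superlevel; exact: measurable_realfun.measurable_funB.
have LU : ~` E = L `|` U.
  apply/seteqP; split => w /=.
    by move=> /negP; rewrite -ltNge ltr_normr opprB => /orP[]; [right|left].
  by move=> h; apply/negP; rewrite -ltNge ltr_normr opprB; apply/orP; case: h; [right|left].
have mE : measurable E by rewrite -[E]setCK LU; exact/measurableC/measurableU.
split=> //; rewrite -probability_setC// LU.
apply/esym/measureU => //.
by rewrite -subset0 /L /U => w /= [? ?]; lra.
Qed.

Theorem proposition1 (R : realType) (d : measure_display) (T : measurableType d)
    (P : probability T R) (p : R) (hp0 : 0 < p) (hp1 : p < 1)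
    (X : nat -> {RV P >-> R}) (hX : iid X)
    (hX1 : forall i, P [set w | X i w = 1] = p%:E)
    (hX0 : forall i, P [set w | X i w = 0] = (1 - p)%:E) :
  exists eps : R^nat,
    [/\ forall n, 0 < eps n,
        eps n @[n --> \oo] --> (0 : R),
        eps n ^+ 2 * n%:R @[n --> \oo] --> (0 : R)
      & (lower_tail X p eps n + upper_tail X p eps n)%E @[n --> \oo] --> 1%:E].
Proof.
pose eps : R^nat := fun n => harmonic n / 2.
have eps0 n : 0 < eps n by rewrite divr_gt0 ?invr_gt0.
have epsn n : n%:R * eps n < 2^-1.
  rewrite /eps /harmonic/= mulrA gtr_pMl ?invr_gt0//.
  by rewrite ltr_pdivrMr// mul1r ltr_nat.
have eps_cvg : eps n @[n --> \oo] --> (0 : R).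
  rewrite -[X in _ --> X](mul0r (2^-1 : R)).
  by apply: cvgM; [exact: cvg_harmonic|exact: cvg_cst].
exists eps; split=> //.
  apply: (@squeeze_cvgr _ _ _ _ (fun=> 0) eps) => //; last exact: cvg_cst.
  near=> n; rewrite mulr_ge0 ?sqr_ge0//=.
  rewrite expr2 -mulrA ger_pMr// mulrC; have := epsn n; lra.
(* k n is the integer nearest to n * p, hence the only one within distance
   less than 1/2 of it. *)
pose k n := Num.truncn (n%:R * p + 2^-1).
have k_itv n : (k n)%:R <= n%:R * p + 2^-1 < (k n).+1%:R.
  by apply: truncn_itv; rewrite addr_ge0// mulr_ge0// ltW.
have k_near n : `|(k n)%:R - n%:R * p| <= 1.
  by move: (k_itv n); rewrite -(natr1 (k n)) ler_norml => /andP[? ?]; apply/andP; split; lra.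
pose E n := [set w | `|sample_mean X n w - p| <= eps n].
have mE n : measurable (E n) by case: (tails_complement P X p eps n (eps0 n)).
have PE n : (P (E n) <= (binomial_pmf n p (k n))%:E)%E.
  apply: (probability_le_binomial_pmf P p X hX.1 hX1 hX0) => // w Ew X01.
  have [m mE'] : exists m : nat, \sum_(i < n) X i w = m%:R.
    exists (\sum_(i < n) (X i w == 1%R))%N; rewrite natr_sum.
    apply: eq_bigr => i _; have [->|->] := X01 i (ltn_ord i); last by rewrite eqxx.
    by rewrite eq_sym oner_eq0.
  (* For n = 0 the sample mean is 0, but both sides vanish. *)
  have mean : n%:R * (sample_mean X n w - p) = m%:R - n%:R * p.
    rewrite /sample_mean mulrBr; congr (_ - _).
    have [n0|n0] := posnP n; last by rewrite mulVKf ?pnatr_eq0 -?lt0n.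
    by rewrite -mE' n0 big_ord0 !mul0r.
  have near : `|m%:R - n%:R * p| < 2^-1.
    rewrite -mean normrM ger0_norm//; apply: le_lt_trans (epsn n).
    exact: ler_wpM2l.
  rewrite mE' /k; congr (_%:R); apply/esym/truncn_def.
  by move: near; rewrite ltr_norml -(natr1 m) => /andP[? ?]; apply/andP; split; lra.
have fPE n : P (E n) = (fine (P (E n)))%:E by rewrite fineK// fin_num_measure.
have fE0 : fine (P (E n)) @[n --> \oo] --> (0 : R).
  apply: (@squeeze_cvgr _ _ _ _ (fun=> 0) (fun n => binomial_pmf n p (k n))).
  - near=> n; rewrite fine_ge0//=; by have := PE n; rewrite fPE lee_fin.
  - exact: cvg_cst.
  - exact: binomial_pmf_near_mean_cvg0.
rewrite (_ : (fun n => _) = EFin \o (fun n => 1 - fine (P (E n)))); last first.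
  apply/funext => n /=; rewrite (tails_complement P X p eps n (eps0 n)).2.
  by rewrite -/(E n) EFinB -fPE.
apply/cvg_EFin; first by near=> n.
rewrite -[X in _ --> X](subr0 (1 : R)).
by apply: cvgB => //; exact: cvg_cst.
Unshelve. all: by end_near. Qed.
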